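(* Let $s\in\mathbb{N}$, $s\le T$, and let $\phi$ be a monetary utility function on $\mathcal{R}^\infty_{s,T}$ such that $$\phi(X)={\rm ess}\inf_{a\in\mathcal{M}}\{\langle X,a\rangle_{s,T}-\phi^{\#}(a)\},\qquad X\in\mathcal{R}^\infty_{s,T},$$ for some $\mathcal{M}\subset D_{s,T}$. Suppose $\mathcal{M}$ is compact with respect to $\|\cdot\|_{A^1}$, stable under concatenation, and there is $b\in A^1_+$ with $\Delta a_t\le\Delta b_t$ for all $a\in\mathcal{M}$, $t\in\mathbb{N}$. Then for every $X\in\mathcal{R}^\infty_{s,T}$ there exists $a^X\in\mathcal{M}$ such that the insurance version $\Psi(X):=-\phi(-X)$ satisfies $$\Psi(X)=\langle X,a^X\rangle_{s,T}+\phi^{\#}(a^X).$$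
   Context: Filtered probability space $(\Omega,\mathcal{F},(\mathcal{F}_t)_{t\in\mathbb{N}},P)$, $\mathcal{F}_0$ trivial; a.s. (in)equalities; $T\in\mathbb{N}$ fixed. $\mathcal{R}^\infty$: bounded adapted processes; $A^1$: adapted $a$ with $\|a\|_{A^1}:=E\sum_t|\Delta a_t|<\infty$ ($a_{-1}=0$, $\Delta a_t=a_t-a_{t-1}$); $A^1_+$: those with all $\Delta a_t\ge0$. For stopping times $\tau\le\theta$: $\pi_{\tau,\theta}(X)_t=1_{\{\tau\le t\}}X_{t\wedge\theta}$, $\mathcal{R}^\infty_{\tau,\theta}=\pi_{\tau,\theta}\mathcal{R}^\infty$, $A^1_{\tau,\theta}=\pi_{\tau,\theta}A^1$, $\langle X,a\rangle_{\tau,\theta}=E(\sum_{t\in[\tau,\theta]\cap\mathbb{N}}X_t\Delta a_t\mid\mathcal{F}_\tau)$, $D_{s,T}=\{a\in\pi_{s,T}A^1_+:\langle1,a\rangle_{s,T}=1\}$. A monetary utility function on $\mathcal{R}^\infty_{s,T}$ is $\phi:\mathcal{R}^\infty_{s,T}\to L^\infty(\mathcal{F}_s)$ with $\phi(1_AX)=1_A\phi(X)$ for $A\in\mathcal{F}_s$, monotone, and $\phi(X+m1_{[s,\infty)})=\phi(X)+m$ for $m\in L^\infty(\mathcal{F}_s)$; $\mathcal{C}_\phi=\{X:\phi(X)\ge0\}$, $\phi^{\#}(a)={\rm ess}\inf_{X\in\mathcal{C}_\phi}\langle X,a\rangle_{s,T}$. Concatenation: for $a,b\in A^1_+$, a finite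 stopping time $\theta$ and $A\in\mathcal{F}_\theta$, $(a\oplus^\theta_Ab)_t=1_Ca_t+1_{C^c}\big(a_{\theta-1}+\frac{\langle1,a\rangle_{\theta,\infty}}{\langle1,b\rangle_{\theta,\infty}}(b_t-b_{\theta-1})\big)$, where $C=\{t<\theta\}\cup A^c\cup\{\langle1,b\rangle_{\theta,\infty}=0\}$. A set $\mathcal{M}\subset A^1_+$ is stable under concatenation if $a\oplus^\theta_Ab\in\mathcal{M}$ for all $a,b\in\mathcal{M}$, all finite stopping times $\theta$ and all $A\in\mathcal{F}_\theta$. *)

(* Defs.v *)
From HB Require Import structures.
From mathcomp Require Import all_boot all_order all_algebra.
From mathcomp Require Import all_classical all_reals all_analysis measurable_realfun.
Set Implicit Arguments. Unset Strict Implicit. Unset Printing Implicit Defensive.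
Import Order.TTheory GRing.Theory Num.Theory.
Local Open Scope classical_set_scope.
Local Open Scope ring_scope.

Section Setting.
Context {R : realType} {d : measure_display} {Omega : measurableType d}.
Variable (P : probability Omega R).
Variable (F : nat -> set (set Omega)).

Definition process := nat -> Omega -> R.

Definition is_filtration : Prop :=
  [/\ (forall t, sigma_algebra setT (F t)),
      (forall t, F t `<=` measurable),
      (forall t, F t `<=` F t.+1) &
      (forall A, F 0%N A -> A = set0 \/ A = setT)].

Definition G_measurable (G : set (set Omega)) (f : Omega -> R) : Prop :=
  forall B : set R, measurable B -> G (f @^-1` B).

Definition adapted (X : process) : Prop := forall t, G_measurable (F t) (X t).

Definition stopping_time (theta : Omega -> nat) : Prop :=
  forall t, F t [set w | (theta w <= t)%N].

Definition F_at (theta : Omega -> nat) : set (set Omega) :=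
  [set A | measurable A /\ forall t, F t (A `&` [set w | (theta w <= t)%N])].

Definition is_condexp (G : set (set Omega)) (Z Y : Omega -> R) : Prop :=
  [/\ G_measurable G Y, P.-integrable setT (EFin \o Y) &
      forall A, G A -> (\int[P]_(w in A) (Y w)%:E = \int[P]_(w in A) (Z w)%:E)%E].

Definition condexp (G : set (set Omega)) (Z : Omega -> R) : Omega -> R :=
  match pselect (exists Y, is_condexp G Z Y) with
  | left h => projT1 (cid h)
  | right _ => fun _ => 0
  end.

Definition is_essinf (Fam : set (Omega -> \bar R)) (Y : Omega -> \bar R) : Prop :=
  [/\ measurable_fun setT Y,
      (forall f, Fam f -> {ae P, forall w, (Y w <= f w)%E}) &
      (forall Y', measurable_fun setT Y' ->
         (forall f, Fam f -> {ae P, forall w, (Y' w <= f w)%E}) ->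
         {ae P, forall w, (Y' w <= Y w)%E})].

Definition essinf (Fam : set (Omega -> \bar R)) : Omega -> \bar R :=
  match pselect (exists Y, is_essinf Fam Y) with
  | left h => projT1 (cid h)
  | right _ => fun _ => (-oo)%E
  end.

(* increments, with a_{-1} = 0 *)
Definition aprev (a : process) (t : nat) (w : Omega) : R :=
  if t is t'.+1 then a t' w else 0.
Definition delta (a : process) (t : nat) (w : Omega) : R := a t w - aprev a t w.

Definition Rinf (X : process) : Prop :=
  adapted X /\ exists c : R, forall t, {ae P, forall w, `|X t w| <= c}.

Definition A1norm (a : process) : \bar R :=
  (\int[P]_w (\sum_(t <oo) (`|delta a t w|)%:E))%E.
Definition A1 (a : process) : Prop := adapted a /\ (A1norm a < +oo)%E.
Definition A1plus (a : process) : Prop :=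
  A1 a /\ forall t, {ae P, forall w, 0 <= delta a t w}.

Definition pi_st (s T : nat) (X : process) : process :=
  fun t w => if (s <= t)%N then X (minn t T) w else 0.

Definition RinfST (s T : nat) (X : process) : Prop :=
  exists Y, Rinf Y /\ X = pi_st s T Y.

Definition inner (s T : nat) (X a : process) : Omega -> R :=
  condexp (F s) (fun w => \sum_(s <= t < T.+1) X t w * delta a t w).

Definition inner1_inf (theta : Omega -> nat) (a : process) : Omega -> R :=
  condexp (F_at theta)
    (fun w => fine (\sum_(t <oo | (theta w <= t)%N) (delta a t w)%:E)%E).

Definition D_st (s T : nat) (a : process) : Prop :=
  (exists a', A1plus a' /\ a = pi_st s T a') /\
  {ae P, forall w, inner s T (fun _ _ => 1) a w = 1}.

Definition Linf (G : set (set Omega)) (Z : Omega -> R) : Prop :=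
  G_measurable G Z /\ exists c : R, {ae P, forall w, `|Z w| <= c}.

Definition monetary (s T : nat) (phi : process -> Omega -> R) : Prop :=
  [/\ (forall X, RinfST s T X -> Linf (F s) (phi X)),
      (forall X A, RinfST s T X -> F s A ->
         {ae P, forall w, phi (fun t w' => \1_A w' * X t w') w = \1_A w * phi X w}),
      (forall X Y, RinfST s T X -> RinfST s T Y ->
         (forall t, {ae P, forall w, X t w <= Y t w}) ->
         {ae P, forall w, phi X w <= phi Y w}) &
      (forall X m, RinfST s T X -> Linf (F s) m ->
         {ae P, forall w,
            phi (fun t w' => X t w' + (if (s <= t)%N then m w' else 0)) w
            = phi X w + m w})].

Definition Cphi (s T : nat) (phi : process -> Omega -> R) : set process :=
  [set X | RinfST s T X /\ {ae P, forall w, 0 <= phi X w}].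

Definition phisharp (s T : nat) (phi : process -> Omega -> R) (a : process)
  : Omega -> \bar R :=
  essinf [set (fun w => (inner s T X a w)%:E) | X in Cphi s T phi].

Definition Psi (phi : process -> Omega -> R) (X : process) : Omega -> R :=
  fun w => - phi (fun t w' => - X t w') w.

Definition concat (a b : process) (theta : Omega -> nat) (A : set Omega) : process :=
  fun t w =>
    if [|| (t < theta w)%N, ~~ `[< A w >] | inner1_inf theta b w == 0]
    then a t w
    else aprev a (theta w) w
         + inner1_inf theta a w / inner1_inf theta b w
           * (b t w - aprev b (theta w) w).

(* stability under concatenation (elements of M are processes up to a.s.
   equality, so we require a version of the concatenation to lie in M) *)
Definition stable_concat (M : set process) : Prop :=
  forall a b theta A, M a -> M b -> stopping_time theta -> F_at theta A ->
    exists c, M c /\ forall t, {ae P, forall w, c t w = concat a b theta A t w}.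

Definition A1open (U : set process) : Prop :=
  forall a, U a -> exists e : R, 0 < e /\
    forall b, A1 b -> (A1norm (fun t w => (a t w - b t w)%R) < e%:E)%E -> U b.

Definition A1compact (M : set process) : Prop :=
  M `<=` A1 /\
  forall (I : Type) (U : I -> set process),
    (forall i, A1open (U i)) -> (forall a, M a -> exists i, U i a) ->
    exists (n : nat) (f : 'I_n -> I), forall a, M a -> exists k, U (f k) a.

End Setting.

(* Main.v *)
Require Import Defs.
From HB Require Import structures.
From mathcomp Require Import all_boot all_order all_algebra.
From mathcomp Require Import all_classical all_reals all_analysis measurable_realfun.
From mathcomp Require Import lra.
Import Order.TTheory GRing.Theory Num.Theory.
Local Open Scope classical_set_scope.
Local Open Scope ring_scope.

(** Write [f a = <X, a> + phi# a]; the representation says that [Psi X] is the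
    essential supremum of [f] over [M]. Concatenation at the deterministic time
    [s] on a set [A] of [F s] switches from [a] to [b] on [A], so [f] is upward
    directed on [M], and for every [e > 0] some [c] in [M] satisfies
    [P (f c < Psi X - e) < e]. For [Z] acceptable and [A] in [F s], the map
    [a |-> \int_A \sum_t (X_t + Z_t) Delta a_t] is continuous for the [A^1]-norm;
    compactness of [M] therefore yields a single [a] with
    [<X, a> + <Z, a> >= Psi X] for all acceptable [Z] at once, that is,
    [<X, a> + phi# a >= Psi X]. *)

(** The obstacle is that [phi# a] is an essential infimum over uncountably many acceptable [Z],
    possibly [-oo], and comes with no continuity in [a] that would let a maximizing sequence pass to
    the limit. Replacing it by one [Z] at a time gives an expression linear in [a]. Integrating over
    all [A] in [F s] loses nothing, because both sides of the desired inequality are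
    [F s]-measurable, and it turns an almost sure inequality into real ones. If no [a] worked, each
    [a] in [M] would fail some test [(Z, A)] by a positive margin, which is an open condition. A
    finite subcover leaves finitely many tests, and a single approximate maximizer [c] passes all of
    them, a contradiction. The accuracy [e] must be fixed before [c] is known. This is possible
    because the loss on the exceptional event, of probability below [e], is at most [e] times a
    constant independent of [c]: the normalization [<1, c> = 1] bounds [<X, c>] and [<Z, c>] from
    below by the bounds of [X] and [Z] alone. *)

Lemma ereal_rat_between {R : realType} (x y : \bar R) :
  (x < y)%E -> exists q : rat, ((x < (ratr q : R)%:E) && ((ratr q : R)%:E < y))%E.
Proof.
case: x y => [x| |] [y| |]//=.
- rewrite lte_fin => /rat_in_itvoo[q]; rewrite in_itv/= => /andP[xq qy].
  by exists q; rewrite !lte_fin xq.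
- have /rat_in_itvoo[q] : x < x + 1 by rewrite ltrDl.
  by rewrite in_itv/= => /andP[xq _]; exists q; rewrite lte_fin xq ltry.
- have /rat_in_itvoo[q] : y - 1 < y by rewrite ltrBlDr ltrDl.
  by rewrite in_itv/= => /andP[_ qy]; exists q; rewrite lte_fin qy ltNyr.
- by exists 0; rewrite ltNyr ltry.
Qed.

Lemma measurable_fun_inf_range {R : realType} {d : measure_display}
    {T : measurableType d} (f : nat -> T -> \bar R) :
  (forall n, measurable_fun setT (f n)) ->
  measurable_fun setT (fun w => ereal_inf (range (fun n => f n w))).
Proof.
move=> mf.
have : measurable_fun setT (fun w => einfs (fun n => f n w) 0%N).
  by apply: measurable_fun_einfs.
congr measurable_fun; apply/funext => w; congr ereal_inf.
by apply/seteqP; split=> [_ [n _ <-]|_ [n _ <-]]; exists n.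
Qed.

(** * Essential infima of arbitrary families, realized along sequences *)

Section EssentialInfimum.
Set Implicit Arguments.
Unset Strict Implicit.
Context {R : realType} {d : measure_display} {Omega : measurableType d}.
Variable P : probability Omega R.

(* Exhaustion: a countable union of members of nearly maximal measure. *)
Lemma ess_union_countable (J : Type) (D : set J) (E : J -> set Omega) :
  D !=set0 -> (forall j, D j -> measurable (E j)) ->
  exists u : nat -> J, (forall n, D (u n)) /\
    forall j, D j -> P (E j `\` \bigcup_n E (u n)) = 0%E.
Proof.
move=> [j0 Dj0] mE.
have mU (u : nat -> J) : (forall n, D (u n)) -> measurable (\bigcup_n E (u n)).
  by move=> Du; apply: bigcupT_measurable => n; exact/mE.
pose V := [set P (\bigcup_n E (u n)) | u in [set u : nat -> J | forall n, D (u n)]].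
have V0 : V (P (\bigcup_(n : nat) E j0)) by exists (fun=> j0).
have Vle1 : (ereal_sup V <= 1)%E.
  by apply: ge_ereal_sup => _ [u Du <-]; exact/probability_le1/mU.
have Vfin : ereal_sup V \is a fin_num.
  rewrite ge0_fin_numE; first exact: le_lt_trans Vle1 (ltry _).
  apply: le_trans (ereal_sup_ubound V0); exact: measure_ge0.
have /choice[u Hu] : forall k : nat, exists u : nat -> J, (forall n, D (u n)) /\
    (ereal_sup V - (k.+1%:R^-1)%:E < P (\bigcup_n E (u n)))%E.
  move=> k; have k0 : 0 < (k.+1%:R^-1 : R) by rewrite invr_gt0.
  have [_ [u Du <-] ltu] := ub_ereal_sup_adherent k0 Vfin.
  by exists u.
(* Enumerating all pairs [(k, n)] merges the sequences [u k] into one; a code of no pair falls back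
   on [j0], which stays in [D]. *)
pose v n := if @unpickle (nat * nat)%type n is Some p then u p.1 p.2 else j0.
have Dv n : D (v n).
  by rewrite /v; case: unpickle => // p; have [] := Hu p.1.
have subv k : \bigcup_n E (u k n) `<=` \bigcup_n E (v n).
  by move=> w [n _ En]; exists (pickle (k, n)); rewrite // /v pickleK.
exists v; split=> // j Dj.
have PvE : ereal_sup V = P (\bigcup_n E (v n)).
  apply/eqP; rewrite eq_le; apply/andP; split; last first.
    by apply: ereal_sup_ubound; exists v.
  apply/lee_addgt0Pr => e e0.
  have [k ke] : exists k : nat, k.+1%:R^-1 < e.
    by have [k _ /(_ k (leqnn _))] := near_infty_natSinv_lt (PosNum e0); exists k.
  rewrite -leeBlDr//; apply: (@le_trans _ _ (ereal_sup V - (k.+1%:R^-1)%:E)%E).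
    by rewrite leeB// lee_fin ltW.
  apply: le_trans (ltW (Hu k).2) _.
  by apply: le_measure; rewrite ?inE; [exact/mU/(Hu k).1|exact/mU|exact: subv].
(* Prepending [j] gives another competitor for the supremum, which the union along [v] already
   attains; what [E j] adds is therefore null. *)
pose v' n := if n is n'.+1 then v n' else j.
have Dv' n : D (v' n) by case: n.
have mB : measurable (E j `\` \bigcup_n E (v n)).
  by apply: measurableD; [exact: mE|exact: mU].
have : (P ((E j `\` \bigcup_n E (v n)) `|` \bigcup_n E (v n)) <= ereal_sup V)%E.
  have Vv' : V (P (\bigcup_n E (v' n))) by exists v'.
  apply: le_trans (ereal_sup_ubound Vv').
  apply: le_measure; rewrite ?inE; [by apply: measurableU => //; exact: mU|exact: mU|].
  move=> w [[Ew _]|[n _ En]]; first by exists 0%N.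
  by exists n.+1.
rewrite measureU//; [|exact: mU|by rewrite setDE -setIA setICl setI0].
have Pfin : P (\bigcup_n E (v n)) \is a fin_num by rewrite -PvE.
rewrite PvE -[leRHS]add0e leeD2rE// => PB0.
by apply/eqP; rewrite eq_le PB0 measure_ge0.
Qed.

(* Applies the exhaustion to the sets [f j < r] for every rational [r]. *)
Lemma ess_inf_countable (J : Type) (D : set J) (f : J -> Omega -> \bar R) :
  D !=set0 -> (forall j, D j -> measurable_fun setT (f j)) ->
  exists u : nat -> J, (forall n, D (u n)) /\
    forall j, D j ->
      {ae P, forall w, (ereal_inf (range (fun n => f (u n) w)) <= f j w)%E}.
Proof.
move=> D0 mf.
have mlt j (r : rat) : D j -> measurable [set w | (f j w < (ratr r : R)%:E)%E].
  by move=> Dj; have := emeasurable_fun_infty_o measurableT (mf _ Dj) (ratr r)%:E;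
    rewrite setTI.
have /choice[u Hu] : forall r : rat, exists u : nat -> J, (forall n, D (u n)) /\
    forall j, D j -> P ([set w | (f j w < (ratr r : R)%:E)%E] `\`
      \bigcup_n [set w | (f (u n) w < (ratr r : R)%:E)%E]) = 0%E.
  move=> r; apply: (@ess_union_countable _ D
    (fun j => [set w | (f j w < (ratr r : R)%:E)%E])) => // j Dj.
  exact: mlt.
case: D0 => j0 Dj0.
pose v n := if @unpickle (rat * nat)%type n is Some p then u p.1 p.2 else j0.
have Dv n : D (v n).
  by rewrite /v; case: unpickle => // p; have [] := Hu p.1.
exists v; split=> // j Dj.
(* One null set per rational: where the infimum along [v] exceeds [f j], a rational strictly between
   the two puts the point in the corresponding set. *)
pose N (n : nat) := if @unpickle rat n is Some r then
  [set w | (f j w < (ratr r : R)%:E)%E] `\`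
      \bigcup_n [set w | (f (u r n) w < (ratr r : R)%:E)%E] else set0.
have : P.-negligible (\bigcup_n N n).
  apply: negligible_bigcup => n; rewrite /N; case: unpickle => [r|]; last exact: negligible_set0.
  apply/negligibleP; last by have [_] := Hu r; exact.
  apply: measurableD; first exact: mlt.
  by apply: bigcupT_measurable => k; exact/mlt/(Hu r).1.
apply: negligibleS => w /= /negP; rewrite -ltNge => lt.
have [r /andP[r1 r2]] : exists r : rat,
    ((f j w < (ratr r : R)%:E) && ((ratr r : R)%:E < ereal_inf (range (fun n => f (v n) w))))%E.
  exact: ereal_rat_between.
exists (pickle r); first exact: I.
rewrite /N pickleK; split; first exact: r1.
case=> n _; apply/negP; rewrite -leNgt; apply: le_trans (ltW r2) _.
apply: ereal_inf_lbound; exists (pickle (r, n)); first exact: I.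
by rewrite /v pickleK.
Qed.

Lemma ae_le_measure (A B : set Omega) : measurable A -> measurable B ->
  {ae P, forall w, A w -> B w} -> (P A <= P B)%E.
Proof.
move=> mA mB AB.
have AB0 : P (A `\` B) = 0%E.
  apply: measure_negligible; first exact: measurableD.
  by apply: negligibleS AB => w [Aw nBw] /(_ Aw).
rewrite (measureDI P mA mB) [X in (X + _)%E](_ : _ = 0%E) ?add0e//.
by apply: le_measure; rewrite ?inE//; exact: measurableI.
Qed.

Lemma is_essinf_unique (Fam : set (Omega -> \bar R)) (Y Y' : Omega -> \bar R) :
  is_essinf P Fam Y -> is_essinf P Fam Y' -> {ae P, forall w, Y w = Y' w}.
Proof.
move=> [mY lbY gY] [mY' lbY' gY'].
apply: filterS2 (gY _ mY' lbY') (gY' _ mY lbY) => w le1 le2.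
by apply/eqP; rewrite eq_le le1 le2.
Qed.

Lemma is_essinf_inf (J : Type) (D : set J) (f : J -> Omega -> \bar R) (u : nat -> J) :
  (forall j, D j -> measurable_fun setT (f j)) -> (forall n, D (u n)) ->
  (forall j, D j ->
    {ae P, forall w, (ereal_inf (range (fun n => f (u n) w)) <= f j w)%E}) ->
  is_essinf P (f @` D) (fun w => ereal_inf (range (fun n => f (u n) w))).
Proof.
move=> mf Du lbu; split.
- by apply: measurable_fun_inf_range => n; exact/mf.
- by move=> _ [j Dj <-]; exact: lbu.
- move=> Y' _ lbY'.
  have := ae_foralln (fun n => lbY' _ (ex_intro2 _ _ (u n) (Du n) erefl)).
  apply: filterS => w Yle; apply: le_ereal_inf_tmp => _ [n _ <-]; exact: Yle.
Qed.

(** The countable form serves two purposes later: it yields an [F s]-measurable version of [phi#],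
    and it allows the essential supremum over [M] to be approximated by finitely many members. *)
Lemma essinf_countable (J : Type) (D : set J) (f : J -> Omega -> \bar R) :
  D !=set0 -> (forall j, D j -> measurable_fun setT (f j)) ->
  exists u : nat -> J, (forall n, D (u n)) /\
    is_essinf P (f @` D) (fun w => ereal_inf (range (fun n => f (u n) w))).
Proof.
move=> D0 mf; have [u [Du lbu]] := ess_inf_countable D0 mf.
by exists u; split=> //; exact: is_essinf_inf.
Qed.

Lemma essinfP (Fam : set (Omega -> \bar R)) :
  (exists Y, is_essinf P Fam Y) -> is_essinf P Fam (essinf P Fam).
Proof. by rewrite /essinf; case: pselect => // h _; exact: (projT2 (cid h)). Qed.

End EssentialInfimum.

(** * Conditional expectation given a sub-sigma-algebra, and its localization to sets of that
    sigma-algebra *)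

Section ConditionalExpectation.
Set Implicit Arguments.
Unset Strict Implicit.
Context {R : realType} {d : measure_display} {Omega : measurableType d}.
Variables (P : probability Omega R) (G : set (set Omega)).
Hypotheses (sG : sigma_algebra setT G) (GM : G `<=` measurable).

Let OG := g_sigma_algebraType G.
Let idG : Omega -> OG := id.

Lemma G_measurableP (f : Omega -> R) :
  G_measurable G f <-> measurable_fun setT (f : OG -> R).
Proof.
have mG := measurable_g_measurableTypeE sG.
split=> [mf _ B mB|mf B mB]; rewrite ?setTI.
  by rewrite mG; exact: mf.
by have := mf measurableT B mB; rewrite setTI mG.
Qed.

Lemma measurable_sub_sigma d' (U : measurableType d') (f : Omega -> U) :
  measurable_fun setT (f : OG -> U) -> measurable_fun setT f.
Proof.
have mG := measurable_g_measurableTypeE sG.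
by move=> mf _ B mB; apply: GM; rewrite -mG; exact: mf.
Qed.

Lemma G_measurable_measurable (f : Omega -> R) :
  G_measurable G f -> measurable_fun setT f.
Proof. by move=> /G_measurableP; exact: measurable_sub_sigma. Qed.

Let measurable_idG : measurable_fun setT idG.
Proof.
apply: (@measurable_sub_sigma _ OG idG); exact: (@measurable_id _ OG setT).
Qed.

#[local] HB.instance Definition _ :=
  @isMeasurableFun.Build _ _ _ _ idG measurable_idG.

(* Radon-Nikodym on the measurable space [(Omega, G)]. *)
Lemma condexp_exists (Z : Omega -> R) : P.-integrable setT (EFin \o Z) ->
  exists Y, is_condexp P G Z Y.
Proof.
have mG := measurable_g_measurableTypeE sG.
move=> iZ.
(* [nu] is the charge [A |-> \int_A Z] and [Q] is [P], both carried by the identity to the coarser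
   space; [nu << Q] since an integral over a null set vanishes. *)
pose nu0 : {charge set Omega -> \bar R} := induced_charge iZ.
pose nu : {charge set OG -> \bar R} :=
  measure_function_pushforward__canonical__charge_Charge nu0 measurable_idG.
pose Q : probability OG R := distribution P (idG : {mfun Omega >-> OG}).
have dom : nu `<< Q.
  apply/null_content_dominatesP => A mA QA.
  have mA' : (measurable : set (set Omega)) A by apply: GM; rewrite -mG.
  apply: null_set_integral => //.
  exact/measurable_funTS/(measurable_int P).
pose h : OG -> \bar R := Radon_Nikodym nu Q.
have iQ : Q.-integrable setT h := Radon_Nikodym_integrable dom.
have mQ : measurable_fun setT h := measurable_int _ iQ.
have iP : P.-integrable setT (h : Omega -> \bar R).
  apply/integrableP; split; first exact: measurable_sub_sigma.
  have /integrableP[_] := iQ.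
  rewrite ge0_integral_pushforward//.
  by apply: measurableT_comp.
have fineE w : ((fine (h w))%:E = h w)%E.
  by rewrite fineK//; exact: Radon_Nikodym_fin_num.
exists (fun w => fine (h w)); split.
- apply/G_measurableP.
  apply: (measurableT_comp (f := fine) (g := h)) => //.
- by move: iP; apply: eq_integrable => // w _ /=; rewrite fineE.
- move=> A GA.
  have mA : (measurable : set (set OG)) A by rewrite mG.
  under eq_integral do rewrite fineE.
  have -> : (\int[P]_(x in A) (Z x)%:E)%E = nu A by [].
  rewrite (Radon_Nikodym_integral dom mA) integral_pushforward//.
  by apply: integrableS iP => //; exact: GM.
Qed.

Lemma condexpP (Z : Omega -> R) : P.-integrable setT (EFin \o Z) ->
  is_condexp P G Z (condexp P G Z).
Proof.
move=> /condexp_exists; rewrite /condexp.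
by case: pselect => // h _; exact: (projT2 (cid h)).
Qed.

(** The default branch of [condexp] is the constant 0, so this covers every [Z]. *)
Lemma condexp_measurable (Z : Omega -> R) : G_measurable G (condexp P G Z).
Proof.
rewrite /condexp; case: pselect => [h|_]; first by case: (projT2 (cid h)).
exact/G_measurableP.
Qed.

Lemma is_condexp_integral (Z Y : Omega -> R) (A : set Omega) :
  is_condexp P G Z Y -> G A -> \int[P]_(w in A) Y w = \int[P]_(w in A) Z w.
Proof. by case=> _ _ ZY GA; rewrite /Rintegral ZY. Qed.

Lemma G_measurable_lt (f g : Omega -> R) (A : set Omega) :
  G_measurable G f -> G_measurable G g -> G A ->
  G (A `&` [set w | f w < g w]).
Proof.
have mG := measurable_g_measurableTypeE sG.
move=> /G_measurableP mf /G_measurableP mg GA.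
rewrite -mG; apply: measurableI; first by rewrite mG.
rewrite -[X in measurable X]setTI.
under eq_set do rewrite -lte_fin.
by apply: measurable_lte => //; exact/measurable_EFinP.
Qed.

(* Testing on the set where the inequality fails. *)
Lemma ae_le_of_integral (Y Y' : Omega -> R) (A : set Omega) :
  G_measurable G Y -> G_measurable G Y' ->
  P.-integrable setT (EFin \o Y) -> P.-integrable setT (EFin \o Y') -> G A ->
  (forall B, G B -> B `<=` A ->
    \int[P]_(w in B) Y w <= \int[P]_(w in B) Y' w) ->
  {ae P, forall w, A w -> Y w <= Y' w}.
Proof.
move=> mY mY' iY iY' GA le.
pose B := A `&` [set w | Y' w < Y w].
have GB : G B by exact: G_measurable_lt.
have mB : measurable B by exact: GM.
have iYB : P.-integrable B (EFin \o Y) by exact: integrableS iY.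
have iYB' : P.-integrable B (EFin \o Y') by exact: integrableS iY'.
have iB : P.-integrable B (EFin \o (fun w => Y w - Y' w)).
  by have := integrableB mB iYB iYB'; apply: eq_integrable => // w _.
have /eqP : \int[P]_(w in B) (Y w - Y' w) = 0.
  apply/eqP; rewrite eq_le; apply/andP; split.
    by rewrite RintegralB// subr_le0; apply: le => // w [].
  by apply: Rintegral_ge0 => w [_ /= lt]; rewrite subr_ge0 ltW.
rewrite /Rintegral fine_eq0; last exact: integrable_fin_num.
move=> /eqP int0.
have : (\int[P]_(w in B) `|(Y w - Y' w)%:E| = 0)%E.
  rewrite -[RHS]int0; apply: eq_integral => w; rewrite inE => -[_ /= lt].
  by rewrite ger0_norm// subr_ge0 ltW.
move=> /ae_eq_integral_abs => /(_ mB (measurable_int P iB)).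
apply: filterS => w h Aw; rewrite leNgt; apply/negP => lt.
have := h (conj Aw lt); case=> /eqP; rewrite subr_eq0 => /eqP e.
by rewrite e ltxx in lt.
Qed.

Lemma ae_le_Rintegral (f g : Omega -> R) (A : set Omega) : measurable A ->
  P.-integrable setT (EFin \o f) -> P.-integrable setT (EFin \o g) ->
  {ae P, forall w, A w -> f w <= g w} ->
  \int[P]_(w in A) f w <= \int[P]_(w in A) g w.
Proof.
move=> mA fi gi fg.
have fiA : P.-integrable A (EFin \o f) by exact: integrableS fi.
have giA : P.-integrable A (EFin \o g) by exact: integrableS gi.
rewrite -subr_ge0 -RintegralB//.
have iB : P.-integrable A (EFin \o (fun w => g w - f w)).
  by have := integrableB mA giA fiA; apply: eq_integrable => // w _.
have mB := measurable_int P iB.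
(* The difference is nonnegative only almost everywhere; its absolute value has the same integral
   and is nonnegative at every point. *)
suff -> : \int[P]_(x in A) (g x - f x) = \int[P]_(x in A) `|g x - f x|.
  by apply: Rintegral_ge0.
congr fine; apply: ae_eq_integral => //.
  by apply/measurable_EFinP/measurableT_comp => //; exact/measurable_EFinP.
apply: filterS fg => w h /h le.
by rewrite /= ger0_norm// subr_ge0.
Qed.

Lemma is_condexp_le (Z Z' Y Y' : Omega -> R) (A : set Omega) :
  P.-integrable setT (EFin \o Z) -> P.-integrable setT (EFin \o Z') ->
  is_condexp P G Z Y -> is_condexp P G Z' Y' -> G A ->
  {ae P, forall w, A w -> Z w <= Z' w} -> {ae P, forall w, A w -> Y w <= Y' w}.
Proof.
move=> iZ iZ' cY cY' GA ZZ'; have [mY iY _] := cY; have [mY' iY' _] := cY'.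
apply: ae_le_of_integral => // B GB BA.
rewrite (is_condexp_integral cY)// (is_condexp_integral cY')//.
apply: ae_le_Rintegral => //; first exact: GM.
by apply: filterS ZZ' => w + /BA; exact.
Qed.

Lemma is_condexp_eq (Z Z' Y Y' : Omega -> R) (A : set Omega) :
  P.-integrable setT (EFin \o Z) -> P.-integrable setT (EFin \o Z') ->
  is_condexp P G Z Y -> is_condexp P G Z' Y' -> G A ->
  {ae P, forall w, A w -> Z w = Z' w} -> {ae P, forall w, A w -> Y w = Y' w}.
Proof.
move=> iZ iZ' cY cY' GA ZZ'.
have le1 : {ae P, forall w, A w -> Y w <= Y' w}.
  by apply: is_condexp_le iZ iZ' cY cY' GA _; apply: filterS ZZ' => w h /h ->.
have le2 : {ae P, forall w, A w -> Y' w <= Y w}.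
  by apply: is_condexp_le iZ' iZ cY' cY GA _; apply: filterS ZZ' => w h /h ->.
apply: filterS2 le1 le2 => w h1 h2 Aw.
by apply/eqP; rewrite eq_le h1// h2.
Qed.

Lemma is_condexpZ (k : R) (Z Y : Omega -> R) :
  P.-integrable setT (EFin \o Z) ->
  is_condexp P G Z Y -> is_condexp P G (fun w => k * Z w) (fun w => k * Y w).
Proof.
move=> iZ [mY iY ZY]; split.
- by apply/G_measurableP/measurable_funM => //; exact/G_measurableP.
- by have := integrableZl measurableT k iY; apply: eq_integrable.
- move=> A GA; have mA := GM GA.
  under eq_integral do rewrite EFinM; under [RHS]eq_integral do rewrite EFinM.
  rewrite (@integralZl _ _ _ P A mA (EFin \o Y)) ?(@integralZl _ _ _ P A mA (EFin \o Z)).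
  - by rewrite ZY.
  - exact: integrableS iZ.
  - exact: integrableS iY.
Qed.

Lemma sigma_algebraT : G setT.
Proof. by case: sG => G0 GC _; rewrite -(setD0 setT); exact: GC. Qed.

Lemma sigma_algebraN (A : set Omega) : G A -> G (~` A).
Proof. by case: sG => _ GC _ GA; rewrite -setTD; exact: GC. Qed.

End ConditionalExpectation.

(** * The integrand of [<X, a>]: integrability and continuity in [a] *)

Section Pairing.
Set Implicit Arguments.
Unset Strict Implicit.
Context {R : realType} {d : measure_display} {Omega : measurableType d}.
Variables (P : probability Omega R) (F : nat -> set (set Omega)) (s T : nat).
Hypothesis hF : is_filtration F.
Implicit Types (a X : @process R d Omega).

Let sF t : sigma_algebra setT (F t). Proof. by have [] := hF. Qed.
Let FM t : F t `<=` measurable. Proof. by have [] := hF. Qed.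

(** Weaker than [RinfST]: it also covers the constant process 1, which for [s > 0] does not vanish
    before [s]. The sign of [c] is recorded so that estimates can be multiplied by it. *)
Definition bounded_by (c : R) X :=
  [/\ 0 <= c, forall t, measurable_fun setT (X t) &
      forall t, {ae P, forall w, `|X t w| <= c}].

(** The random variable under the conditional expectation in [inner]. Over sets of [F s] both have
    the same integral, but this one depends on [a] pointwise and not through a chosen version. *)
Definition pairing X a w := \sum_(s <= t < T.+1) X t w * delta a t w.

Lemma RinfST_bounded X : RinfST P F s T X -> exists c, bounded_by c X.
Proof.
move=> [Y [[aY [c Yc]] ->]].
have c0 : 0 <= Num.max c 0 by rewrite le_max lexx orbT.
exists (Num.max c 0); split=> // t; rewrite /pi_st; case: (s <= t)%N => //.
- exact: (G_measurable_measurable (sF _) (@FM _) (aY _)).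
- by apply: filterS (Yc (minn t T)) => w le; rewrite le_max le.
- by apply: aeW => w; rewrite normr0.
Qed.

Lemma bounded_byD c1 c2 X1 X2 : bounded_by c1 X1 -> bounded_by c2 X2 ->
  bounded_by (c1 + c2) (fun t w => X1 t w + X2 t w).
Proof.
move=> [c10 mX1 X1c] [c20 mX2 X2c]; split=> [|t|t].
- exact: addr_ge0.
- exact: measurable_funD.
- apply: filterS2 (X1c t) (X2c t) => w h1 h2.
  by apply: le_trans (ler_normD _ _) _; exact: lerD.
Qed.

Lemma bounded_by_cst1 : bounded_by 1 (fun _ _ => 1).
Proof. by split=> // t; apply: aeW => w; rewrite normr1. Qed.

Lemma delta_measurable a t : adapted F a -> measurable_fun setT (delta a t).
Proof.
move=> aa; apply: measurable_funB.
  exact: (G_measurable_measurable (sF _) (@FM _) (aa _)).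
case: t => [|t] /=; first exact: measurable_cst.
exact: (G_measurable_measurable (sF _) (@FM _) (aa _)).
Qed.

Lemma delta_series_measurable a : adapted F a ->
  measurable_fun setT (fun w => (\sum_(t <oo) (`|delta a t w|)%:E)%E).
Proof.
move=> aa; apply: ge0_emeasurable_sum => // t _.
apply/measurable_EFinP/measurableT_comp => //; exact: delta_measurable.
Qed.

Lemma adaptedB a1 a2 : adapted F a1 -> adapted F a2 ->
  adapted F (fun t w => a1 t w - a2 t w).
Proof.
move=> h1 h2 t; apply/(G_measurableP (sF t)).
by apply: measurable_funB; apply/(G_measurableP (sF t)).
Qed.

Lemma sum_delta_le_series a (m n : nat) w :
  ((\sum_(m <= t < n) `|delta a t w|)%:E <= \sum_(t <oo) (`|delta a t w|)%:E)%E.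
Proof.
have [nm|mn] := leqP n m.
  by rewrite big_geq//; apply: nneseries_ge0.
apply: (@le_trans _ _ (\sum_(0 <= t < n) (`|delta a t w|)%:E)%E).
  rewrite sumEFin lee_fin (@big_cat_nat _ _ _ m 0 n)//=; last exact: ltnW.
  by rewrite lerDr sumr_ge0.
exact: (@nneseries_lim_ge R (fun t => (`|delta a t w|)%:E) xpredT).
Qed.

Lemma delta_integrable a t : A1 P F a -> P.-integrable setT (EFin \o delta a t).
Proof.
move=> [aa fin]; apply/integrableP; split.
  exact/measurable_EFinP/delta_measurable.
apply: le_lt_trans fin; apply: ge0_le_integral => //.
- apply: measurableT_comp => //; exact/measurable_EFinP/delta_measurable.
- exact: delta_series_measurable.
- by move=> w _; have := @sum_delta_le_series a t t.+1 w; rewrite big_nat1.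
Qed.

Lemma integrable_mul_bounded (c : R) (g f : Omega -> R) :
  measurable_fun setT g -> {ae P, forall w, `|g w| <= c} ->
  P.-integrable setT (EFin \o f) -> P.-integrable setT (EFin \o (fun w => g w * f w)).
Proof.
move=> mg gc fi.
have mf : measurable_fun setT f by exact/measurable_EFinP/(measurable_int P).
apply/integrableP; split; first exact/measurable_EFinP/measurable_funM.
have /integrableP[_] := integrableZl measurableT c fi.
apply: le_lt_trans; apply: ae_ge0_le_integral => //.
- apply: measurableT_comp => //; exact/measurable_EFinP/measurable_funM.
- apply: measurableT_comp => //; apply/measurable_EFinP/measurable_funM => //.
- apply: filterS gc => w le _ /=; rewrite lee_fin !normrM ler_wpM2r//.
  exact: le_trans le (ler_norm _).
Qed.

Lemma integrable_bounded (k : R) (f : Omega -> R) : measurable_fun setT f ->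
  {ae P, forall w, `|f w| <= k} -> P.-integrable setT (EFin \o f).
Proof.
move=> mf fk.
have i1 : P.-integrable setT (EFin \o (fun=> 1 : R)).
  by apply: finite_measure_integrable_cst.
have := integrable_mul_bounded mf fk i1.
by apply: eq_integrable => // w _ /=; rewrite mulr1.
Qed.

Lemma pairing_integrable c X a : bounded_by c X -> A1 P F a ->
  P.-integrable setT (EFin \o pairing X a).
Proof.
move=> [_ mX Xc] a1.
have -> : EFin \o pairing X a =
    (fun w => \sum_(s <= t < T.+1) (X t w * delta a t w)%:E)%E.
  by apply/funext => w; rewrite /= /pairing sumEFin.
apply: integrable_sum => // t _.
exact: integrable_mul_bounded (mX t) (Xc t) (delta_integrable t a1).
Qed.

Lemma innerP c X a : bounded_by c X -> A1 P F a ->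
  is_condexp P (F s) (pairing X a) (inner P F s T X a).
Proof. by move=> Xc a1; apply: condexpP => //; exact: pairing_integrable Xc a1. Qed.

Lemma inner_measurable X a : G_measurable (F s) (inner P F s T X a).
Proof. exact: condexp_measurable. Qed.

Lemma deltaB a1 a2 t w :
  delta (fun t w => a1 t w - a2 t w) t w = delta a1 t w - delta a2 t w.
Proof.
rewrite /delta; case: t => [|t] /=; first by rewrite !subr0.
by rewrite !opprD !opprK addrACA.
Qed.

(** The integrands differ by at most [c] times the total variation of [a1 - a2], whose expectation
    is the [A1norm]; enlarging [A] to the whole space makes the modulus independent of [A]. *)
Lemma pairing_continuous c X a1 a2 (A : set Omega) (e : R) :
  bounded_by c X -> A1 P F a1 -> A1 P F a2 -> measurable A ->
  (A1norm P (fun t w => (a1 t w - a2 t w)%R) < e%:E)%E ->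
  `|\int[P]_(w in A) pairing X a1 w - \int[P]_(w in A) pairing X a2 w| <= c * e.
Proof.
move=> Xc h1 h2 mA lt; have [c0 mX ubX] := Xc.
have i1 := pairing_integrable Xc h1; have i2 := pairing_integrable Xc h2.
have i1A : P.-integrable A (EFin \o pairing X a1) by exact: integrableS i1.
have i2A : P.-integrable A (EFin \o pairing X a2) by exact: integrableS i2.
have iBT : P.-integrable setT (EFin \o (fun w => pairing X a1 w - pairing X a2 w)).
  by have := integrableB measurableT i1 i2; apply: eq_integrable => // w _.
have iB : P.-integrable A (EFin \o (fun w => pairing X a1 w - pairing X a2 w)).
  exact: integrableS iBT.
rewrite -RintegralB// -lee_fin EFin_normr_Rintegral//.
have mB := measurable_int P iB; have mBT := measurable_int P iBT.
apply: le_trans (le_abse_integral P mA mB) _.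
apply: (@le_trans _ _ (\int[P]_w `|(pairing X a1 w - pairing X a2 w)%:E|)%E).
  by apply: ge0_subset_integral => //; exact: measurableT_comp.
have aB : adapted F (fun t w => a1 t w - a2 t w) by apply: adaptedB; [case: h1|case: h2].
pose S w := (\sum_(t <oo) (`|delta (fun t w => a1 t w - a2 t w)%R t w|)%:E)%E.
apply: (@le_trans _ _ (\int[P]_w (c%:E * S w))%E); last first.
  rewrite ge0_integralZl//.
  - by rewrite EFinM lee_wpmul2l// ltW.
  - exact: delta_series_measurable.
  - by move=> w _; exact: nneseries_ge0.
apply: ae_ge0_le_integral => //.
- exact: measurableT_comp.
- by move=> w _; rewrite mule_ge0//; exact: nneseries_ge0.
- by apply: measurable_funeM; exact: delta_series_measurable.
- apply: filterS (ae_foralln ubX) => w le _.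
  apply: (@le_trans _ _ (c%:E *
      (\sum_(s <= t < T.+1) `|delta (fun t w => a1 t w - a2 t w)%R t w|)%:E)%E).
    rewrite -EFinM lee_fin /pairing -sumrB mulr_sumr.
    apply: le_trans (ler_norm_sum _ _ _) _; apply: ler_sum => t _.
    by rewrite -mulrBr normrM deltaB ler_wpM2r.
  by apply: lee_wpmul2l => //; exact: sum_delta_le_series.
Qed.

Lemma pairing_ae_eq X a1 a2 (A : set Omega) :
  (forall t, {ae P, forall w, A w -> a1 t w = a2 t w}) ->
  {ae P, forall w, A w -> pairing X a1 w = pairing X a2 w}.
Proof.
move=> /ae_foralln; apply: filterS => w e Aw; apply: eq_bigr => t _.
congr (_ * _); rewrite /delta; congr (_ - _); first exact: e.
by case: t => //= t; exact: e.
Qed.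

End Pairing.

(** * Concatenation at the constant time [s] as pasting on sets of [F s] *)

Section Concatenation.
Set Implicit Arguments.
Unset Strict Implicit.
Context {R : realType} {d : measure_display} {Omega : measurableType d}.
Variables (P : probability Omega R) (F : nat -> set (set Omega)) (s T : nat).
Hypotheses (hF : is_filtration F) (sT : (s <= T)%N).
Implicit Types (a b X : @process R d Omega).

Let sF t : sigma_algebra setT (F t). Proof. by have [] := hF. Qed.
Let FM t : F t `<=` measurable. Proof. by have [] := hF. Qed.

Lemma filtration_homo t u : (t <= u)%N -> F t `<=` F u.
Proof.
have [_ _ Fmono _] := hF.
move=> /subnK <-; elim: (u - t)%N => // n IH.
by rewrite addSn; exact: subset_trans (IH) (Fmono _).
Qed.

Let set_true : [set _ : Omega | true] = setT.
Proof. by apply/seteqP; split. Qed.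

Let set_false : [set _ : Omega | false] = set0.
Proof. by apply/seteqP; split. Qed.

Lemma F_at_cst : F_at F (fun=> s) = F s.
Proof.
apply/seteqP; split=> [A [_ /(_ s)]|A FA].
  by rewrite /= leqnn set_true setIT.
split=> [|t]; first exact: FM FA.
have [st|ts] := leqP s t.
  by rewrite /= set_true setIT; exact: filtration_homo FA.
by rewrite /= set_false setI0; have [] := sF t.
Qed.

Lemma stopping_time_cst : stopping_time F (fun=> s).
Proof.
move=> t; have [st|ts] := leqP s t.
  by rewrite /= set_true; exact: sigma_algebraT (sF t).
by rewrite /= set_false; have [] := sF t.
Qed.

(** The increment of the projection at time [s] is the whole accumulated value [a s], so
    nonnegativity of all earlier increments enters, starting from [aprev a 0 = 0]. *)
Lemma delta_pi_st_ge0 a : (forall t, {ae P, forall w, 0 <= delta a t w}) ->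
  forall t, {ae P, forall w, 0 <= delta (pi_st s T a) t w}.
Proof.
move=> /ae_foralln a0 t; apply: filterS a0 => w a0.
have ale u : aprev a u w <= a u w by rewrite -subr_ge0; exact: a0.
have age u : 0 <= a u w.
  by elim: u => [|u IH]; [exact: (ale 0%N)|exact: le_trans IH (ale u.+1)].
rewrite subr_ge0 /pi_st; case: t => [|t] /=; first by case: ifP.
have [st|ts] := leqP s t; last by case: ifP.
rewrite (leqW st); have [tT|Tt] := ltnP t T.
  by rewrite (minn_idPl tT); exact: (ale t.+1).
by rewrite (minn_idPr (leqW Tt)).
Qed.

Lemma delta_pi_st_eq0 a t w : (T < t)%N -> delta (pi_st s T a) t w = 0.
Proof.
case: t => // t; rewrite ltnS => Tt.
have st := leq_trans sT Tt.
by rewrite /delta /= /pi_st st (leqW st) (minn_idPr Tt) (minn_idPr (leqW Tt)) subrr.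
Qed.

Lemma aprev_pi_st a w : aprev (pi_st s T a) s w = 0.
Proof. by case: s => //= n; rewrite /pi_st ltnn. Qed.

(** Identifies the mass after [s] used by [concat] with the one that [D_st] normalizes to 1. Both
    conditional expectations have the same integrand, since the projected process is frozen after
    [T]. *)
Lemma inner1_inf_cst a :
  inner1_inf P F (fun=> s) (pi_st s T a) = inner P F s T (fun _ _ => 1) (pi_st s T a).
Proof.
rewrite /inner1_inf /inner F_at_cst; congr condexp; apply/funext => w.
set b := pi_st s T a.
suff -> : (\sum_(t <oo | (s <= t)%N) (delta b t w)%:E =
    (\sum_(s <= t < T.+1) delta b t w)%:E)%E.
  by apply: eq_bigr => t _; rewrite mul1r.
apply: cvg_lim => //; apply: cvg_near_cst; exists T.+1 => // n /= Tn.
rewrite (@big_cat_nat _ _ _ T.+1)//= [X in (_ + X)%E]big1_seq ?adde0; last first.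
  move=> t /andP[_]; rewrite mem_index_iota => /andP[Tt _].
  by rewrite delta_pi_st_eq0.
rewrite (@big_cat_nat _ _ _ s)//=; last exact: leqW.
rewrite [X in (X + _)%E]big1_seq ?add0e; last first.
  by move=> t /andP[st]; rewrite mem_index_iota => /andP[_]; rewrite ltnNge st.
rewrite -sumEFin big_nat_cond [RHS]big_nat_cond.
by apply: eq_bigl => t; case: (s <= t)%N => //=; rewrite andbT.
Qed.

(* Both processes start at [s] with unit conditional mass, so the rescaling
   factor is 1. *)
Lemma concat_cst a b (A : set Omega) t :
  D_st P F s T a -> D_st P F s T b ->
  {ae P, forall w, concat P F a b (fun=> s) A t w
                   = if `[< A w >] then b t w else a t w}.
Proof.
move=> [[a' [_ ->]] a1] [[b' [_ ->]] b1].
apply: filterS2 a1 b1 => w a1 b1.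
rewrite /concat !inner1_inf_cst a1 b1 oner_eq0 orbF divr1 mul1r.
rewrite !aprev_pi_st subr0 add0r.
(* Before [s] both processes vanish, so keeping [a] there is the same as having switched to [b]. *)
have [ts|st] := ltnP t s; last by case: `[< A w >].
by rewrite /= /pi_st leqNgt ts; case: ifP.
Qed.

Lemma paste (M : set (@process R d Omega)) a b (A : set Omega) :
  M `<=` D_st P F s T -> stable_concat P F M -> M a -> M b -> F s A ->
  exists c, [/\ M c, forall t, {ae P, forall w, A w -> c t w = b t w} &
                forall t, {ae P, forall w, (~` A) w -> c t w = a t w}].
Proof.
move=> MD stM Ma Mb FA.
have FA' : F_at F (fun=> s) A by rewrite F_at_cst.
have [c [Mc cE]] := stM a b _ A Ma Mb stopping_time_cst FA'.
exists c; split=> // t.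
  apply: filterS2 (cE t) (concat_cst A t (MD _ Ma) (MD _ Mb)) => w -> -> Aw.
  by case: asboolP.
apply: filterS2 (cE t) (concat_cst A t (MD _ Ma) (MD _ Mb)) => w -> -> Aw.
by case: asboolP.
Qed.

(** Locality: [A] lies in the conditioning sigma-algebra, so changing [a] outside [A] does not
    affect the conditional expectation on [A]. *)
Lemma inner_ae_eq c X a b (A : set Omega) : bounded_by P c X ->
  A1 P F a -> A1 P F b -> F s A ->
  (forall t, {ae P, forall w, A w -> a t w = b t w}) ->
  {ae P, forall w, A w -> inner P F s T X a w = inner P F s T X b w}.
Proof.
move=> Xc a1 b1 FA ab.
exact: (is_condexp_eq (sF s) (@FM s) (pairing_integrable s T hF Xc a1)
  (pairing_integrable s T hF Xc b1) (innerP s T hF Xc a1) (innerP s T hF Xc b1)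
  FA (pairing_ae_eq s T X ab)).
Qed.

(* [<X, a> >= - c <1, a> = - c] *)
Lemma inner_ge c X a : bounded_by P c X -> A1 P F a -> D_st P F s T a ->
  {ae P, forall w, - c <= inner P F s T X a w}.
Proof.
move=> Xc a1 [[a' [[_ a'0] aE]] a_one]; have [c0 mX ubX] := Xc.
have X1 := @bounded_by_cst1 _ _ _ P.
have i1 := pairing_integrable s T hF X1 a1.
have i1c : P.-integrable setT (EFin \o (fun w => - c * pairing s T (fun _ _ => 1) a w)).
  by have := integrableZl measurableT (- c) i1; apply: eq_integrable.
have := is_condexp_le (sF s) (@FM s) i1c (pairing_integrable s T hF Xc a1)
  (is_condexpZ (sF s) (@FM s) (- c) i1 (innerP s T hF X1 a1)) (innerP s T hF Xc a1)
  (sigma_algebraT (sF s)).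
move=> le; apply: filterS2 a_one (le _) => [w e /(_ I)|]; first by rewrite e mulr1.
rewrite aE; apply: filterS2 (ae_foralln (delta_pi_st_ge0 a'0)) (ae_foralln ubX).
move=> w ge0 ub _; rewrite /pairing mulr_sumr; apply: ler_sum => t _.
rewrite mul1r ler_wpM2r//.
by have /ler_normlP[] := ub t; rewrite lerNl.
Qed.

(** [condexp] picks a version by choice, so even this sign rule holds only almost surely. *)
Lemma innerN c X a : bounded_by P c X -> A1 P F a ->
  {ae P, forall w, inner P F s T (fun t w => - X t w) a w = - inner P F s T X a w}.
Proof.
move=> Xc a1.
have XNc : bounded_by P c (fun t w => - X t w).
  have [c0 mX ubX] := Xc; split=> // t; first exact: measurableT_comp.
  by apply: filterS (ubX t) => w; rewrite normrN.
have iX := pairing_integrable s T hF Xc a1.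
have iZ : P.-integrable setT (EFin \o (fun w => -1 * pairing s T X a w)).
  by have := integrableZl measurableT (-1) iX; apply: eq_integrable.
have := is_condexp_eq (sF s) (@FM s) (pairing_integrable s T hF XNc a1) iZ
  (innerP s T hF XNc a1) (is_condexpZ (sF s) (@FM s) (-1) iX (innerP s T hF Xc a1))
  (sigma_algebraT (sF s)).
move=> h; apply: filterS (h _) => [w /(_ I)|]; first by rewrite mulN1r.
apply: aeW => w _; rewrite mulN1r /pairing -sumrN.
by apply: eq_bigr => t _; rewrite mulNr.
Qed.

End Concatenation.

(** * Directedness, approximate maximizers and the compactness argument *)

Section Attainment.
Set Implicit Arguments.
Unset Strict Implicit.
Context {R : realType} {d : measure_display} {Omega : measurableType d}.
Variables (P : probability Omega R) (F : nat -> set (set Omega)) (s T : nat).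
Variables (phi : @process R d Omega -> Omega -> R) (M : set (@process R d Omega)).
Hypotheses (hF : is_filtration F) (sT : (s <= T)%N).
Hypotheses (hphi : monetary P F s T phi) (MD : M `<=` D_st P F s T).
Hypotheses (cM : A1compact P F M) (stM : stable_concat P F M).
Implicit Types (a b c X Z : @process R d Omega).

Let sF t : sigma_algebra setT (F t). Proof. by have [] := hF. Qed.
Let FM t : F t `<=` measurable. Proof. by have [] := hF. Qed.
Let M1 a : M a -> A1 P F a. Proof. by have [h _] := cM; exact: h. Qed.
Let mG := measurable_g_measurableTypeE (sF s).

Notation "<< X , a >>" := (inner P F s T X a).
Notation sharp := (phisharp P F s T phi).

(** Locality of [phi] on the empty set forces [phi 0 = 0]. Acceptable processes thus exist, as the
    exhaustion behind [phi#] requires. *)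
Lemma Cphi_zero : Cphi P F s T phi (fun _ _ => 0).
Proof.
have R0 : RinfST P F s T (fun _ _ => 0).
  exists (fun _ _ => 0); split; last first.
    by apply/funext => t; apply/funext => w; rewrite /pi_st; case: ifP.
  split; first by move=> t; apply/(G_measurableP (sF t)); exact: measurable_cst.
  by exists 0 => t; apply: aeW => w; rewrite normr0.
split=> //; have [_ loc _ _] := hphi; have [F0 _ _] := sF s.
have := loc _ set0 R0 F0.
rewrite (_ : (fun _ w' => \1_set0 w' * 0) = (fun (_ : nat) (_ : Omega) => 0 : R)).
  by apply: filterS => w ->; rewrite indicE in_set0 mul0r.
by apply/funext => t; apply/funext => w; rewrite mulr0.
Qed.

Lemma inner_emeasurable X a : measurable_fun setT (fun w => (<<X, a>> w)%:E).
Proof.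
apply/measurable_EFinP.
exact: (G_measurable_measurable (sF s) (@FM s) (inner_measurable P s T hF X a)).
Qed.

Lemma phisharp_essinf a :
  is_essinf P [set (fun w => (<<X, a>> w)%:E) | X in Cphi P F s T phi] (sharp a).
Proof.
apply: essinfP.
have [u [_ h]] := @essinf_countable _ _ _ P _ (Cphi P F s T phi)
  (fun X w => (<<X, a>> w)%:E) (ex_intro _ _ Cphi_zero)
  (fun X _ => inner_emeasurable X a).
by eexists; exact: h.
Qed.

(** [is_essinf] only gives measurability for the ambient sigma-algebra, whereas pasting needs the
    set where one value exceeds another to lie in [F s]. A countable infimum of [F s]-measurable
    functions supplies the version. *)
Lemma phisharp_version a : exists g : g_sigma_algebraType (F s) -> \bar R,
  measurable_fun setT g /\ {ae P, forall w, sharp a w = g w}.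
Proof.
have [u [_ h]] := @essinf_countable _ _ _ P _ (Cphi P F s T phi)
  (fun X w => (<<X, a>> w)%:E) (ex_intro _ _ Cphi_zero)
  (fun X _ => inner_emeasurable X a).
exists (fun w => ereal_inf (range (fun n => (<<u n, a>> w)%:E))); split.
  apply: (@measurable_fun_inf_range R _ (g_sigma_algebraType (F s))
    (fun n w => (<<u n, a>> w)%:E)) => n.
  apply/measurable_EFinP/(G_measurableP (sF s)); exact: inner_measurable.
exact: is_essinf_unique (phisharp_essinf a) h.
Qed.

Definition value X a w : \bar R := ((<<X, a>> w)%:E + sharp a w)%E.

Lemma value_measurable X a : measurable_fun setT (value X a).
Proof.
apply: emeasurable_funD; first exact: inner_emeasurable.
by have [] := phisharp_essinf a.
Qed.

(** Paste [b] over [a] on the set where [b] has the larger value. Both terms of [value] follow the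
    switch, so the value of [c] dominates the maximum of the two. *)
Lemma value_directed X a b : RinfST P F s T X -> M a -> M b ->
  exists c, M c /\
    {ae P, forall w, (value X a w <= value X c w)%E /\ (value X b w <= value X c w)%E}.
Proof.
move=> RX Ma Mb; have [k Xk] := RinfST_bounded hF RX.
have [ga [mga gaE]] := phisharp_version a.
have [gb [mgb gbE]] := phisharp_version b.
pose va w := ((<<X, a>> w)%:E + ga w)%E; pose vb w := ((<<X, b>> w)%:E + gb w)%E.
have mva : measurable_fun setT (va : g_sigma_algebraType (F s) -> \bar R).
  apply: emeasurable_funD => //; apply/measurable_EFinP/(G_measurableP (sF s)).
  exact: inner_measurable.
have mvb : measurable_fun setT (vb : g_sigma_algebraType (F s) -> \bar R).
  apply: emeasurable_funD => //; apply/measurable_EFinP/(G_measurableP (sF s)).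
  exact: inner_measurable.
pose t w := (va w < vb w)%E; pose A := [set w | t w].
have mt : measurable_fun setT t.
  apply: (measurable_sub_sigma (sF s) (@FM s)).
  exact: (@measurable_fun_lte _ (g_sigma_algebraType (F s)) R setT va vb).
have FA : F s A.
  rewrite -mG -[X in measurable X]setTI.
  exact: (@measurable_lte _ (g_sigma_algebraType (F s)) R setT measurableT va vb).
have [c [Mc cb ca]] := paste hF sT MD stM Ma Mb FA.
exists c; split=> //.
have innc k' Z : bounded_by P k' Z ->
    {ae P, forall w, <<Z, c>> w = if t w then <<Z, b>> w else <<Z, a>> w}.
  move=> Zk.
  have e1 := inner_ae_eq T hF Zk (M1 Mc) (M1 Mb) FA cb.
  have e2 := inner_ae_eq T hF Zk (M1 Mc) (M1 Ma) (sigma_algebraN (sF s) FA) ca.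
  apply: filterS2 e1 e2 => w h1 h2; case: ifPn => tw; first exact: h1.
  by apply: h2; exact/negP.
have [_ lba _] := phisharp_essinf a; have [_ lbb _] := phisharp_essinf b.
have [_ _ ubc] := phisharp_essinf c.
(* Only this inequality is required: the switched function is a lower bound of every [<Z, c>], hence
   lies below the greatest one. *)
have sharpc : {ae P, forall w, ((if t w then sharp b w else sharp a w) <= sharp c w)%E}.
  apply: ubc.
    apply: measurable_fun_ifT => //; first by have [] := phisharp_essinf b.
    by have [] := phisharp_essinf a.
  move=> _ [Z CZ <-]; have [k' Zk'] := RinfST_bounded hF (proj1 CZ).
  have lbaZ := lba _ (ex_intro2 _ _ Z CZ erefl).
  have lbbZ := lbb _ (ex_intro2 _ _ Z CZ erefl).
  apply: filterS3 (innc _ _ Zk') lbaZ lbbZ => w ->.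
  by case: ifP.
have gE : {ae P, forall w, sharp a w = ga w /\ sharp b w = gb w}.
  by apply: filterS2 gaE gbE.
apply: filterS3 (innc _ _ Xk) sharpc gE => w e lec [ea eb].
rewrite /value e ea eb; move: lec; rewrite ea eb.
case: ifPn => tw lec.
  split; last by rewrite leeD2lE.
  by apply: le_trans (ltW tw) _; rewrite leeD2lE.
split; first by rewrite leeD2lE.
by move: tw; rewrite -leNgt => /le_trans; apply; rewrite leeD2lE.
Qed.

Lemma value_directed_seq X (u : nat -> @process R d Omega) n :
  RinfST P F s T X -> (forall i, M (u i)) ->
  exists c, M c /\
    {ae P, forall w, forall i, (i <= n)%N -> (value X (u i) w <= value X c w)%E}.
Proof.
move=> RX Mu; elim: n => [|n [c [Mc IH]]].
  exists (u 0%N); split=> //; apply: aeW => w i.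
  by rewrite leqn0 => /eqP ->.
have [c' [Mc' h]] := value_directed RX Mc (Mu n.+1).
exists c'; split=> //; apply: filterS2 IH h => w IH [h1 h2] i.
rewrite leq_eqVlt => /predU1P[->//|]; rewrite ltnS => /IH le.
exact: le_trans le h1.
Qed.

Hypothesis hess : forall X, RinfST P F s T X ->
  is_essinf P [set (fun w => ((<<X, a>> w)%:E - sharp a w)%E) | a in M]
    (fun w => (phi X w)%:E).

Lemma RinfSTN X : RinfST P F s T X -> RinfST P F s T (fun t w => - X t w).
Proof.
move=> [Y [[aY [k Yk]] ->]]; exists (fun t w => - Y t w); split; last first.
  by apply/funext => t; apply/funext => w; rewrite /pi_st; case: ifP; rewrite ?oppr0.
split.
  move=> t; apply/(G_measurableP (sF t)); apply: measurableT_comp => //.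
  exact/(G_measurableP (sF t)).
by exists k => t; apply: filterS (Yk t) => w; rewrite normrN.
Qed.

Lemma Psi_Linf X : RinfST P F s T X -> Linf P (F s) (Psi phi X).
Proof.
move=> RX; have [h _ _ _] := hphi; have [mphi [k phik]] := h _ (RinfSTN RX).
split; last by exists k; apply: filterS phik => w; rewrite /Psi normrN.
apply/(G_measurableP (sF s)); apply: measurableT_comp => //.
exact/(G_measurableP (sF s)).
Qed.

Lemma innerN_value X a w : <<(fun t w => - X t w), a>> w = - <<X, a>> w ->
  ((<<(fun t w => - X t w), a>> w)%:E - sharp a w = - value X a w)%E.
Proof. by move=> ->; rewrite /value oppeD ?fin_num_adde_defr// EFinN. Qed.

Lemma value_le_Psi X a : RinfST P F s T X -> M a ->
  {ae P, forall w, (value X a w <= (Psi phi X w)%:E)%E}.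
Proof.
move=> RX Ma; have [k Xk] := RinfST_bounded hF RX.
have [_ lb _] := hess (RinfSTN RX).
apply: filterS2 (lb _ (ex_intro2 _ _ a Ma erefl)) (innerN s T hF Xk (M1 Ma)).
by move=> w + e; rewrite innerN_value// /Psi EFinN leeNr.
Qed.

(** Over an empty family [+oo] is a lower bound, and it would lie almost surely below the finite
    [phi X]. *)
Lemma M_nonempty X : RinfST P F s T X -> M !=set0.
Proof.
move=> RX; apply/set0P/eqP => M0.
have [_ _ ub] := hess RX.
have : {ae P, forall w, (+oo <= (phi X w)%:E)%E}.
  by apply: ub => // g [a]; rewrite M0.
have PT : (0 < P setT)%E by rewrite probability_setT.
by have FP := ae_properfilter_algebraOfSetsType PT; move=> /filter_ex[w].
Qed.

(** A sequence in [M] realizes the supremum; continuity of [P] from above reduces it to finitely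
    many terms, and directedness replaces these by one [c]. *)
Lemma value_approx X (e : R) : RinfST P F s T X -> 0 < e ->
  exists c, M c /\
    (P [set w | (value X c w < (Psi phi X w - e)%:E)%E] < e%:E)%E.
Proof.
move=> RX e0; have [k Xk] := RinfST_bounded hF RX.
have mf a : M a -> measurable_fun setT
    (fun w => ((<<(fun t w => - X t w), a>> w)%:E - sharp a w)%E).
  move=> _; apply: emeasurable_funB; first exact: inner_emeasurable.
  by have [] := phisharp_essinf a.
have [u [Mu hu]] := essinf_countable P (M_nonempty RX) mf.
have infE := is_essinf_unique hu (hess (RinfSTN RX)).
have Neq := ae_foralln (fun n => innerN s T hF Xk (M1 (Mu n))).
have mPsi : measurable_fun setT (fun w => (Psi phi X w - e)%:E).
  apply/measurable_EFinP/measurable_funB => //.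
  exact: (G_measurable_measurable (sF s) (@FM s) (Psi_Linf RX).1).
have mlt a : measurable [set w | (value X a w < (Psi phi X w - e)%:E)%E].
  rewrite -[X in measurable X]setTI.
  by apply: measurable_lte => //; exact: value_measurable.
(* The event that none of [u 0], ..., [u n] comes within [e] of [Psi X]; these events decrease to a
   null set. *)
pose B n := \bigcap_(i in `I_n.+1) [set w | (value X (u i) w < (Psi phi X w - e)%:E)%E].
have mB n : measurable (B n) by apply: bigcap_measurableType => i _; exact: mlt.
have mBcap : measurable (\bigcap_n B n) by apply: bigcapT_measurable.
have PB0 : P (\bigcap_n B n) = 0%E.
  apply: measure_negligible => //.
  have : {ae P, forall w, ~ (\bigcap_n B n) w}.
    (* On the intersection every term of the representation of [phi (-X)] is at least
       [phi (-X) + e], which contradicts that their infimum is [phi (-X)]. *)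
    apply: filterS2 infE Neq => w e1 e2 Bw.
    suff : ((phi (fun t w => - X t w) w + e)%:E <= (phi (fun t w => - X t w) w)%:E)%E.
      by rewrite lee_fin gerDl leNgt e0.
    rewrite -[leRHS]e1; apply: le_ereal_inf_tmp => _ [n _ <-].
    rewrite innerN_value//; have := Bw n I n (ltnSn n); rewrite /= /Psi => lt.
    by rewrite leeNr -EFinN opprD ltW.
  by apply: negligibleS => w Bw; exact.
have cvgB : P (B n) @[n --> \oo] --> (0 : \bar R)%E.
  rewrite -PB0; apply: nonincreasing_cvg_mu => //.
    by rewrite (le_lt_trans (probability_le1 _ _))// ltry.
  move=> m n mn; apply/subsetPset => w Bw i /= im; apply: Bw => /=.
  exact: leq_trans im _.
have [n PBn] : exists n, (P (B n) < e%:E)%E.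
  apply: contrapT => /forallNP PBge.
  have : (e%:E <= 0)%E.
    apply: cvge_ge cvgB; apply: nearW => n.
    by rewrite leNgt; apply/negP; exact: PBge.
  by rewrite lee_fin leNgt e0.
have [c [Mc h]] := value_directed_seq n RX Mu.
exists c; split=> //; apply: le_lt_trans PBn.
apply: ae_le_measure => //.
apply: filterS h => w h lt i; rewrite /= ltnS => /h le; exact: le_lt_trans le lt.
Qed.

(* Off the set where [value X c < Psi X - e] the integrand is at least
   [Psi X - e]; on it, only the uniform lower bound of [inner_ge] is available. *)
Lemma pairing_ge X Z : RinfST P F s T X -> Cphi P F s T phi Z ->
  exists L : R, 0 <= L /\ forall (e : R) c (A : set Omega), 0 < e -> M c -> F s A ->
    (P [set w | (value X c w < (Psi phi X w - e)%:E)%E] < e%:E)%E ->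
    \int[P]_(w in A) Psi phi X w - e * (1 + L) <=
      \int[P]_(w in A) pairing s T (fun t w => X t w + Z t w) c w.
Proof.
move=> RX CZ; have RZ := proj1 CZ.
have [kX Xk] := RinfST_bounded hF RX; have [kZ Zk] := RinfST_bounded hF RZ.
have [mPsi [kP Pk]] := Psi_Linf RX.
have mPsi' := G_measurable_measurable (sF s) (@FM s) mPsi.
have iPsi := integrable_bounded mPsi' Pk.
have kX0 : 0 <= kX by have [] := Xk.
have kZ0 : 0 <= kZ by have [] := Zk.
(* On the exceptional event [Psi X <= |kP|], while [<X, c> + <Z, c> >= - kX - kZ]: the deficit is at
   most [L], whatever [c] is. *)
pose L := `|kP| + kX + kZ.
have L0 : 0 <= L by rewrite !addr_ge0.
exists L; split=> // e c A e0 Mc FA PB.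
set B := [set w | _] in PB.
have mA := FM FA.
have mB : measurable B.
  rewrite -[X in measurable X]setTI; apply: measurable_lte => //.
    exact: value_measurable.
  by apply/measurable_EFinP/measurable_funB.
have c1 := M1 Mc.
have iX := pairing_integrable s T hF Xk c1.
have iZ := pairing_integrable s T hF Zk c1.
have cX := innerP s T hF Xk c1; have cZ := innerP s T hF Zk c1.
have [_ iIX _] := cX; have [_ iIZ _] := cZ.
have iA f : P.-integrable setT (EFin \o f) -> P.-integrable A (EFin \o f).
  by move=> h; exact: integrableS h.
have -> : \int[P]_(w in A) pairing s T (fun t w => X t w + Z t w) c w =
    \int[P]_(w in A) (<<X, c>> w + <<Z, c>> w).
  rewrite RintegralD//; [|exact: iA..].
  rewrite (is_condexp_integral cX)// (is_condexp_integral cZ)// -RintegralD//; [|exact: iA..].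
  apply: eq_Rintegral => w _; rewrite /pairing -big_split/=.
  by apply: eq_bigr => t _; rewrite mulrDl.
have iB : P.-integrable setT (EFin \o (fun w => e + L * \1_B w)).
  apply: (integrable_bounded (k := e + L)).
    by apply: measurable_funD => //; apply: measurable_funM.
  apply: aeW => w; rewrite ger0_norm; last first.
    by rewrite addr_ge0 ?(ltW e0)// mulr_ge0// indicE.
  rewrite lerD2l indicE; case: (w \in B); first by rewrite mulr1.
  by rewrite mulr0.
have iPB : P.-integrable setT (EFin \o (fun w => Psi phi X w - (e + L * \1_B w))).
  by have := integrableB measurableT iPsi iB; apply: eq_integrable.
have iIXZ : P.-integrable setT (EFin \o (fun w => <<X, c>> w + <<Z, c>> w)).
  by have := integrableD measurableT iIX iIZ; apply: eq_integrable.
apply: (@le_trans _ _ (\int[P]_(w in A) (Psi phi X w - (e + L * \1_B w)))).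
  rewrite RintegralB//; [|exact: iA..].
  rewrite lerD2l lerN2.
  (* The correction is nonnegative, so [A] may be enlarged to the whole space, where it integrates
     to [e + L * P B <= e * (1 + L)]. *)
  apply: (@le_trans _ _ (\int[P]_w (e + L * \1_B w))).
    rewrite /Rintegral fine_le//.
    - exact/integrable_fin_num/iA.
    - exact: integrable_fin_num.
    - apply: ge0_subset_integral => //; first exact: measurable_int iB.
      by move=> w _; rewrite lee_fin addr_ge0 ?(ltW e0)// mulr_ge0// indicE.
  have i1 : P.-integrable setT (EFin \o (fun=> e)).
    by apply: finite_measure_integrable_cst.
  have i2 : P.-integrable setT (EFin \o (\1_B : Omega -> R)).
    exact: integrable_indic.
  have i3 : P.-integrable setT (EFin \o (fun w => L * (\1_B w : R))).
    by have := integrableZl measurableT L i2; apply: eq_integrable.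
  rewrite RintegralD// RintegralZl// Rintegral_cst//.
  have PT : fine (P setT) = 1 by rewrite probability_setT.
  rewrite PT mulr1 mulrDr mulr1 lerD2l mulrC ler_wpM2r//.
  rewrite /Rintegral integral_indic// setIT.
  rewrite -lee_fin fineK; first exact: ltW.
  exact: fin_num_measure.
apply: ae_le_Rintegral => //.
have [_ lbc _] := phisharp_essinf c.
have h1 : {ae P, forall w, [/\ (sharp c w <= (<<Z, c>> w)%:E)%E,
    - kX <= <<X, c>> w & - kZ <= <<Z, c>> w]}.
  have lbcZ := lbc _ (ex_intro2 _ _ Z CZ erefl).
  have lX := inner_ge hF Xk c1 (MD Mc); have lZ := inner_ge hF Zk c1 (MD Mc).
  by apply: filterS3 lbcZ lX lZ.
apply: filterS2 h1 Pk => w [h1 h2 h3] h4 _.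
have [wB|wB] := boolP (w \in B); rewrite indicE.
  rewrite wB mulr1 /L.
  have hP : Psi phi X w <= `|kP|.
    exact: le_trans (ler_norm _) (le_trans h4 (ler_norm _)).
  have := ltW e0; lra.
rewrite (negbTE wB) mulr0 addr0 -lee_fin.
move: wB; rewrite notin_setE /B /= => /negP; rewrite -leNgt => le.
apply: le_trans le _; rewrite /value EFinD.
by rewrite leeD2lE.
Qed.

(** The point is the order of quantifiers: [a] is found before [Z]. The null set may still depend on
    [Z]. *)
Lemma attained X : RinfST P F s T X ->
  exists a, M a /\ forall Z, Cphi P F s T phi Z ->
    {ae P, forall w, Psi phi X w <= <<X, a>> w + <<Z, a>> w}.
Proof.
move=> RX; apply: contrapT => /forallNP na.
have [kX Xk] := RinfST_bounded hF RX.
have [mPsi [kP Pk]] := Psi_Linf RX.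
have iPsi := integrable_bounded (G_measurable_measurable (sF s) (@FM s) mPsi) Pk.
pose XZ Z : @process R d Omega := fun t w => X t w + Z t w.
(* The processes failing the test [(Z, A)] by more than [e]. Admissibility of the index is part of
   the membership condition, so a bad index gives the empty set, which is open. *)
pose U (i : @process R d Omega * set Omega * R) : set (@process R d Omega) :=
  let: (Z, A, e) := i in
  [set a | [/\ A1 P F a, Cphi P F s T phi Z, F s A, 0 < e &
    \int[P]_(w in A) pairing s T (XZ Z) a w < \int[P]_(w in A) Psi phi X w - e]].
have oU i : A1open P F (U i).
  case: i => [[Z A] e] a [a1 CZ FA e0 lt].
  have [kZ Zk] := RinfST_bounded hF (proj1 CZ).
  have XZk := bounded_byD Xk Zk; have [k0 _ _] := XZk.
  set k := kX + kZ in XZk k0.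
  set D := (X in _ < X) in lt; set I := (X in X < _) in lt.
  have DI : 0 < D - I by rewrite subr_gt0.
  have k1 : 0 < k + 1 by rewrite ltr_wpDl.
  (* The [+ 1] avoids division by zero and makes [k] times the radius strictly smaller than the
     available margin [D - I]. *)
  exists ((D - I) / (k + 1)); split; first by rewrite divr_gt0.
  move=> b b1 nb; split=> //.
  have := pairing_continuous s T hF XZk a1 b1 (FM FA) nb.
  rewrite -/I -/D; set J := \int[P]_(w in A) _ => le.
  have : k * ((D - I) / (k + 1)) < D - I.
    by rewrite mulrCA gtr_pMr// ltr_pdivrMr// mul1r ltrDl.
  move: le; rewrite ler_norml => /andP[le _]; lra.
have [_ /(_ _ U oU)] := cM.
case.
  move=> a Ma; have nXa := na a.
  have [Z [CZ nae]] : exists Z, Cphi P F s T phi Z /\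
      ~ {ae P, forall w, Psi phi X w <= <<X, a>> w + <<Z, a>> w}.
    apply: contrapT => /forallNP nZ; apply: nXa; split=> // Z CZ.
    by apply: contrapT => nae; apply: (nZ Z).
  have [kZ Zk] := RinfST_bounded hF (proj1 CZ).
  have a1 := M1 Ma.
  have cX := innerP s T hF Xk a1; have cZ := innerP s T hF Zk a1.
  have [mIX iIX _] := cX; have [mIZ iIZ _] := cZ.
  have iX := pairing_integrable s T hF Xk a1; have iZ := pairing_integrable s T hF Zk a1.
  (* If the integral inequality held on every set of [F s], the almost sure inequality would follow
     by [F s]-measurability of both sides. *)
  have [A [FA lt]] : exists A, F s A /\
      \int[P]_(w in A) pairing s T (XZ Z) a w < \int[P]_(w in A) Psi phi X w.
    apply: contrapT => /forallNP nA; apply: nae.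
    have mS : G_measurable (F s) (fun w => <<X, a>> w + <<Z, a>> w).
      by apply/(G_measurableP (sF s))/measurable_funD; exact/(G_measurableP (sF s)).
    have iS : P.-integrable setT (EFin \o (fun w => <<X, a>> w + <<Z, a>> w)).
      by have := integrableD measurableT iIX iIZ; apply: eq_integrable.
    have := ae_le_of_integral (sF s) (@FM s) mPsi mS iPsi iS (sigma_algebraT (sF s)).
    move=> h; apply: filterS (h _) => [w|B FB _]; first exact.
    have iB f : P.-integrable setT (EFin \o f) -> P.-integrable B (EFin \o f).
      by move=> i; apply: integrableS i => //; exact: FM FB.
    have mB := FM FB.
    rewrite RintegralD//; [|exact: iB..].
    rewrite (is_condexp_integral cX)// (is_condexp_integral cZ)// -RintegralD//; [|exact: iB..].
    rewrite leNgt; apply/negP => lt; apply: (nA B); split=> //.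
    move: lt; congr (_ < _); apply: eq_Rintegral => w _; rewrite /pairing -big_split/=.
    by apply: eq_bigr => t _; rewrite mulrDl.
  set D := (X in _ < X) in lt; set I := (X in X < _) in lt.
  (* Half of the gap, since membership in [U] requires a strict inequality. *)
  exists (Z, A, (D - I) / 2); split=> //; first by rewrite divr_gt0// subr_gt0.
  rewrite -/D -/I; lra.
move=> n [f cov].
have /choice[g Hg] : forall k : 'I_n, exists g : R, 0 < g /\
    forall c e, M c -> 0 < e -> e <= g ->
      (P [set w | (value X c w < (Psi phi X w - e)%:E)%E] < e%:E)%E -> ~ U (f k) c.
  move=> k; case: (f k) => [[Z A] e].
  have [[CZ [FA e0]]|nv] := pselect (Cphi P F s T phi Z /\ F s A /\ 0 < e); last first.
    by exists 1; split=> // c e' _ _ _ _ [_ CZ FA e0 _]; apply: nv.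
  have [L [L0 HL]] := pairing_ge RX CZ.
  have L1 : 0 < 1 + L by rewrite ltr_pwDl.
  (* Chosen so that the loss [e' * (1 + L)] of an approximate maximizer does not exceed the margin
     [e] of the test. *)
  exists (e / (1 + L)); split; first by rewrite divr_gt0.
  move=> c e' Mc e'0 le PB [_ _ _ _]; apply/negP; rewrite -leNgt.
  apply: le_trans (HL e' c A e'0 Mc FA PB).
  by rewrite lerD2l lerN2 -ler_pdivlMr.
(* A single accuracy that suits all finitely many tests; the seed 1 keeps it positive even for an
   empty subcover. *)
pose e := \big[Num.min/1]_(k < n) g k.
have e0 : 0 < e by apply: lt_bigmin => // k _; have [] := Hg k.
have [c [Mc PB]] := value_approx RX e0.
have [k Uk] := cov c Mc.
have [_ /(_ c e Mc e0)] := Hg k; apply => //.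
exact: bigmin_le_cond.
Qed.

End Attainment.

Theorem theorem4p1 (R : realType) (d : measure_display) (Omega : measurableType d)
  (P : probability Omega R) (F : nat -> set (set Omega)) (T s : nat)
  (phi : @process R d Omega -> Omega -> R) (M : set (@process R d Omega))
  (b : @process R d Omega) :
  is_filtration F ->
  (s <= T)%N ->
  monetary P F s T phi ->
  M `<=` D_st P F s T ->
  (forall X, RinfST P F s T X ->
     is_essinf P
       [set (fun w => ((inner P F s T X a w)%:E - phisharp P F s T phi a w)%E)
          | a in M]
       (fun w => (phi X w)%:E)) ->
  A1compact P F M ->
  stable_concat P F M ->
  A1plus P F b ->
  (forall a t, M a -> {ae P, forall w, delta a t w <= delta b t w}) ->
  forall X, RinfST P F s T X ->
    exists aX, M aX /\
      {ae P, forall w, (Psi phi X w)%:E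
                       = ((inner P F s T X aX w)%:E + phisharp P F s T phi aX w)%E}.
Proof.
move=> hF sT hphi MD hess cM stM _ _ X RX.
have [a [Ma geZ]] := attained hF sT hphi MD cM stM hess RX.
exists a; split=> //.
have [sF FM _ _] := hF.
have [_ _ glb] := phisharp_essinf hF hphi a.
(* The exceptional null sets depend on [Z] and their union is uncontrolled. The essential infimum
   absorbs this, as [Psi X - <X, a>] only has to be an almost sure lower bound for each [Z]
   separately. *)
have lower : {ae P, forall w,
    ((Psi phi X w - inner P F s T X a w)%:E <= phisharp P F s T phi a w)%E}.
  apply: glb.
    apply/measurable_EFinP/measurable_funB.
      exact: (G_measurable_measurable (sF s) (FM s) (Psi_Linf hF hphi RX).1).
    exact: (G_measurable_measurable (sF s) (FM s) (inner_measurable P s T hF X a)).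
  move=> _ [Z CZ <-]; apply: filterS (geZ Z CZ) => w.
  by rewrite lee_fin lerBlDl.
apply: filterS2 lower (value_le_Psi hF cM hess RX Ma) => w le1 le2.
apply/eqP; rewrite eq_le le2 andbT.
by move: le1; rewrite EFinB leeBlDl.
Qed.
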